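(* Let $d$ be a positive integer and let $(A_1,A_2,A_3)=(3,2,\infty)$. Define sets $T_n$ recursively by $T_1=\{[(1),(1)]\}$ and, for $2\le n\le 6(d-2)$, obtain $T_n$ as follows: (1) form all pairs $[\mathrm{Insert}(g_0,i,n),\mathrm{Insert}(g_1,j,n)]$ with $[g_0,g_1]\in T_{n-1}$ and $i,j\in\{1,\ldots,n\}$, $(i,j)\ne(n,n)$; (2) keep only those pairs $[g_0,g_1]$ for which $[g_0,g_1,(g_0g_1)^{-1}]$ is planar and has weighted-count $\le d$; (3) replace each remaining pair by $\mathrm{UniqueRepresentative}(g_0,g_1)$, a canonical representative of its simultaneous $S_n$-conjugacy class. Then the set $$\{[g_0,g_1]\in T_n \mid n\le 6(d-2),\ |E|=d\}$$ contains exactly one representative of each planar dessin with $|E|=d$, and nothing else.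
   Context: A 3-constellation of degree $n$ is a list $[g_0,g_1,g_\infty]$ in $S_n$ with $g_0g_1g_\infty=1$ generating a transitive subgroup; it is represented by the pair $[g_0,g_1]$, with $g_\infty=(g_0g_1)^{-1}$. It is planar if $\#g_0+\#g_1+\#g_\infty=n+2$, where $\#g$ counts cycles including 1-cycles. A dessin is a simultaneous-conjugacy class (under $S_n$) of 3-constellations. $\mathrm{Insert}(g,i,n)$, for $g\in S_{n-1}$ and $i\in\{1,\ldots,n\}$: write $g$ as a product of disjoint cycles including 1-cycles. There are $n$ positions at which the new number $n$ can be inserted: directly after one of the $n-1$ entries inside its cycle (positions $1,\ldots,n-1$, in some fixed order), or as a new 1-cycle $(n)$ (position $n$). $\mathrm{Insert}(g,i,n)\in S_n$ is the result of inserting $n$ in the $i$-th position. $|E|$ and weighted-count, for $(A_1,A_2,A_3)$: let $e_{1,j},e_{2,j},e_{3,j}$ be the cycle lengths (including 1-cycles) of $g_0,g_1,g_\infty$ respectively. $|E|$ is the number of pairs $(i,j)$ such that $A_i=\infty$ or $A_i\nmid e_{i,j}$. The weighted-count is $\sum_{i,j}s_{i,j}$, where $s_{i,j}=1$ if $A_i=\infty$; and for $A_i$ finite, $s_{i,j}=0$ if $A_i\mid e_{i,j}$, $s_{i,j}=\frac12$ if $e_{i,j}\equiv-1 \bmod A_i$, and $s_{i,j}=1$ otherwise. $\mathrm{UniqueRepresentative}$ is a function assigning to each transitive list of permutations in $S_n$ an element of its simultaneous $S_n$-conjugacy class that depends only on that class. *)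

(* Defs.v *)
From mathcomp Require Import all_boot all_order all_algebra.
From mathcomp Require Import all_fingroup all_solvable.

Set Implicit Arguments.
Unset Strict Implicit.
Unset Printing Implicit Defensive.

Import GroupScope.

(* S_n is 'S_n = {perm 'I_n}: the numbers 1, ..., n are the elements 0, ..., n-1
   of 'I_n. Products are left to right: (s * t) x = t (s x). *)

Definition transitive_list n m (t : m.-tuple 'S_n) : bool :=
  [transitive <<[set g in t]>>, on [set: 'I_n] | 'P].

(* c = [g_0, g_1, g_oo]. For n = 0 nothing is transitive, so constellations have
   positive degree. *)
Definition constellation n (c : 3.-tuple 'S_n) : bool :=
  (\prod_(i < 3) tnth c i == 1) && transitive_list c.

Definition completion n (t : 2.-tuple 'S_n) : 3.-tuple 'S_n :=
  let g0 := tnth t ord0 in let g1 := tnth t ord_max in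
  [tuple g0; g1; (g0 * g1)^-1].

Definition conj_class n m (t : m.-tuple 'S_n) : {set m.-tuple 'S_n} :=
  orbit ('J * m)%act [set: 'S_n] t.

Definition dessin n (c : 3.-tuple 'S_n) : {set 3.-tuple 'S_n} := conj_class c.

(* porbits g is the set of supports of the cycles of g, fixed points included. *)
Definition planar n (c : 3.-tuple 'S_n) : bool :=
  (\sum_(i < 3) #|porbits (tnth c i)|)%N == n.+2.

(* In a triple (A_1, A_2, A_3), None stands for oo. *)
Definition exceptional (a : option nat) (e : nat) : bool :=
  if a is Some k then ~~ (k %| e) else true.

Definition card_E (A : 3.-tuple (option nat)) n (c : 3.-tuple 'S_n) : nat :=
  \sum_(i < 3) #|[set C in porbits (tnth c i) | exceptional (tnth A i) #|C| ]|.

(* e = -1 mod k is expressed as k %| e + 1. *)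
Definition cycle_weight (a : option nat) (e : nat) : rat :=
  if a is Some k then
    if k %| e then 0%R else if k %| e.+1 then (1 / 2)%R else 1%R
  else 1%R.

Definition weighted_count (A : 3.-tuple (option nat)) n (c : 3.-tuple 'S_n) :
    rat :=
  (\sum_(i < 3) \sum_(C in porbits (tnth c i))
     cycle_weight (tnth A i) #|C|)%R.

(* The new number is ord_max. lift_perm ord_max ord_max g extends g by fixing
   it; if i <> ord_max, the product sends i to ord_max and ord_max to g i, i.e.
   ord_max is inserted directly after i; if i = ord_max, tperm is the identity
   and ord_max is a new 1-cycle. *)
Definition insert n (g : 'S_n) (i : 'I_n.+1) : 'S_n.+1 :=
  tperm i ord_max * lift_perm ord_max ord_max g.

Definition is_unique_representative
    (U : forall n m, m.-tuple 'S_n -> m.-tuple 'S_n) : Prop :=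
  forall n m (t : m.-tuple 'S_n), transitive_list t ->
    U n m t \in conj_class t /\
    (forall t', t' \in conj_class t -> U n m t' = U n m t).

Definition inserted_pairs n (T : {set 2.-tuple 'S_n}) :
    {set 2.-tuple 'S_n.+1} :=
  [set [tuple insert (tnth t ord0) ij.1; insert (tnth t ord_max) ij.2]
    | t in T, ij in [set ij : 'I_n.+1 * 'I_n.+1 | ij != (ord_max, ord_max)]].

Definition kept_pairs (A : 3.-tuple (option nat)) (d n : nat)
    (P : {set 2.-tuple 'S_n}) : {set 2.-tuple 'S_n} :=
  [set t in P | planar (completion t) &
                (weighted_count A (completion t) <= d%:R)%R].

(* T_n, with T_0 empty. *)
Fixpoint search (U : forall n m, m.-tuple 'S_n -> m.-tuple 'S_n)
    (A : 3.-tuple (option nat)) (d n : nat) : {set 2.-tuple 'S_n} :=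
  match n with
  | 0 => set0
  | k.+1 =>
      if k == 0 then [set [tuple 1; 1]]
      else [set U k.+1 2 t | t in kept_pairs A d (inserted_pairs (search U A d k))]
  end.

(* The degree n part of { [g_0, g_1] in T_n | n <= 6 (d - 2), |E| = d }; the
   bound is computed in int, where d - 2 may be negative. *)
Definition search_result (U : forall n m, m.-tuple 'S_n -> m.-tuple 'S_n)
    (A : 3.-tuple (option nat)) (d n : nat) : {set 2.-tuple 'S_n} :=
  [set t in search U A d n | (n%:Z <= 6%:Z * (d%:Z - 2%:Z))%R &
                             card_E A (completion t) == d].

(* Main.v *)
Require Import Defs.
From mathcomp Require Import all_boot all_order all_algebra.
From mathcomp Require Import all_fingroup all_solvable.
From mathcomp Require Import zify lra.

Set Implicit Arguments.
Unset Strict Implicit.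
Unset Printing Implicit Defensive.

Import Order.TTheory GRing.Theory Num.Theory GroupScope.

(* Regard [g0, g1] as a plane bipartite map whose edges are the permuted numbers.
   Undoing an insertion deletes an edge. Deleting an edge incident to a leaf, or one
   lying between two different faces, keeps the map connected and planar. It does not
   increase the weighted count: the cycle of g0 or g1 shortened at an end that is not a
   leaf costs at most 1/2, a leaf gives back at least 1/2, and merging two faces gives
   back 1. A planar map with no leaf has such an edge by Euler's formula, since it has
   at most n vertices and hence at least two faces. As the weighted count is at most
   |E|, every planar dessin with |E| = d is reached from degree 1. Its degree n
   satisfies n + 12 <= 6 |E|, because 3 #g0 <= n + 2 |E_0| and 2 #g1 <= n + |E_1|. *)

(** * Cycles of a permutation: conjugation and counting *)

Lemma porbit_invariant (T : finType) (s : {perm T}) (S : {set T}) x :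
  (forall y, y \in S -> s y \in S) -> x \in S -> porbit s x \subset S.
Proof.
move=> S_s Sx; apply/subsetP => _ /porbitP[k ->].
by elim: k => [|k IHk]; rewrite ?perm1 // expgSr permM S_s.
Qed.

Lemma mem_porbit_perm (T : finType) (s : {perm T}) x y :
  (s y \in porbit s x) = (y \in porbit s x).
Proof.
by have := porbit_perm s 1 y; rewrite -!eq_porbit_mem expg1 => ->.
Qed.

Lemma porbit_conj (T : finType) (s u : {perm T}) x :
  porbit (s ^ u) (u x) = u @: porbit s x.
Proof.
have sub (t v : {perm T}) y : porbit (t ^ v) (v y) \subset v @: porbit t y.
  apply: porbit_invariant => [_ /imsetP[z zy ->]|]; last exact/imset_f/porbit_id.
  by rewrite permJ imset_f // mem_porbit_perm.
apply/eqP; rewrite eqEsubset sub /=; apply/subsetP => _ /imsetP[y yx ->].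
have /subsetP/(_ y) := sub (s ^ u) u^-1 (u x).
rewrite conjgK permK => /(_ yx) /imsetP[z zx ->].
by rewrite permKV.
Qed.

(** Conjugation carries cycles to cycles of the same length. Leaving the operation and [F] free
    covers the number of cycles, the weights and the exceptional cycles at once. *)
Lemma big_porbits_conj (R : Type) (idx : R) (op : Monoid.com_law idx)
    (T : finType) (s u : {perm T}) (F : nat -> R) :
  \big[op/idx]_(C in porbits (s ^ u)) F #|C| =
  \big[op/idx]_(C in porbits s) F #|C|.
Proof.
have -> : porbits (s ^ u) = [set u @: (C : {set T}) | C in porbits s].
  apply/setP => C; apply/imsetP/imsetP => [[x _ ->]|[_ /imsetP[x _ ->] ->]].
    by exists (porbit s (u^-1 x)); rewrite ?imset_f // -porbit_conj permKV.
  by exists (u x); rewrite ?porbit_conj.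
rewrite big_imset /=; last by move=> B C _ _; apply/imset_inj/perm_inj.
by apply: eq_bigr => C _; rewrite card_imset //; apply: perm_inj.
Qed.

Lemma sum_card_porbits (T : finType) (s : {perm T}) :
  \sum_(C in porbits s) #|C| = #|T|.
Proof.
rewrite -sum1_card [RHS](partition_big_imset (porbit s)) /=.
apply: eq_bigr => _ /imsetP[x _ ->]; rewrite -sum1_card.
by apply: eq_bigl => y; rewrite eq_porbit_mem.
Qed.

(** Sum the hypothesis over all cycles, whose lengths add up to [#|T|]. With [P] empty this bounds
    the number of vertices of a leafless map; with [P] non-divisibility by [k] it yields the degree
    bound. *)
Lemma card_porbits_bound (T : finType) (s : {perm T}) k (P : pred {set T}) :
  (forall C, C \in porbits s -> k <= #|C| + k.-1 * P C) ->
  k * #|porbits s| <= #|T| + k.-1 * #|[set C in porbits s | P C]|.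
Proof.
move=> le_k; rewrite -(sum_card_porbits s) -sum1_card big_distrr /=.
have -> : #|[set C in porbits s | P C]| = \sum_(C in porbits s) P C.
  rewrite -sum1_card big_mkcond [RHS]big_mkcond /=.
  by apply: eq_bigr => C _; rewrite inE; case: (C \in _); case: (P C).
by rewrite big_distrr -big_split leq_sum // => C; rewrite muln1; apply: le_k.
Qed.

Lemma card_porbit_gt0 (T : finType) (s : {perm T}) C :
  C \in porbits s -> 0 < #|C|.
Proof. by case/imsetP=> x _ ->; rewrite lt0n card_porbit_neq0. Qed.

(** * Cycles after an insertion *)

(* [ord_max] is sent to the element [k] after which it was inserted, so that the
   cycles of [insert g (lift ord_max k)] are the preimages of those of [g]. *)
Definition collapse n (k : 'I_n) (x : 'I_n.+1) : 'I_n :=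
  odflt k (unlift ord_max x).

Lemma collapse_lift n (k y : 'I_n) : collapse k (lift ord_max y) = y.
Proof. by rewrite /collapse liftK. Qed.

Lemma collapse_max n (k : 'I_n) : collapse k ord_max = k.
Proof. by rewrite /collapse unlift_none. Qed.

Lemma liftF n (y : 'I_n) : (lift ord_max y == ord_max) = false.
Proof. by rewrite eq_sym (negPf (neq_lift _ _)). Qed.

Lemma insert_id n (g : 'S_n) i : insert g i i = ord_max.
Proof. by rewrite permM tpermL lift_perm_id. Qed.

Lemma insert_max n (g : 'S_n) k :
  insert g (lift ord_max k) ord_max = lift ord_max (g k).
Proof. by rewrite permM tpermR lift_perm_lift. Qed.

Lemma insert_lift n (g : 'S_n) i y :
  i != lift ord_max y -> insert g i (lift ord_max y) = lift ord_max (g y).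
Proof.
by move=> iy; rewrite permM tpermD ?lift_perm_lift // neq_lift.
Qed.

(** The insertion point can only be the preimage of [ord_max]. Left multiplication by the
    transposition of the two makes [ord_max] a fixed point, and what remains restricts to ['I_n]. *)
Lemma insertP n (g : 'S_n.+1) : exists g' : 'S_n, exists i, g = insert g' i.
Proof.
have [h hE] : exists h, h = tperm (g^-1 ord_max) ord_max * g by eexists.
have h_max : h ord_max = ord_max by rewrite hE permM tpermR permKV.
(* The default [y] is never returned: [h] fixes [ord_max], so it sends no lifted element there. *)
pose f (y : 'I_n) := odflt y (unlift ord_max (h (lift ord_max y))).
have fE y : lift ord_max (f y) = h (lift ord_max y).
  rewrite /f; case: unliftP => [z -> //|].
  by rewrite -{2}h_max => /perm_inj/eqP; rewrite liftF.
have f_inj : injective f.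
  move=> y z /(congr1 (lift ord_max)); rewrite !fE.
  by move=> /perm_inj/lift_inj.
exists (perm f_inj), (g^-1 ord_max).
suff lift_h : lift_perm ord_max ord_max (perm f_inj) = h.
  by rewrite /insert lift_h hE mulgA tperm2 mul1g.
apply/permP => x; case: (unliftP ord_max x) => [y ->|->].
  by rewrite lift_perm_lift permE fE.
by rewrite lift_perm_id h_max.
Qed.

(** Seen through [collapse k], a step of the new permutation either rests or is a step of [g]; hence
    preimages of [g]-stable sets are stable. If [i = ord_max], the new point is fixed and may be
    collapsed onto any [k]. *)
Lemma collapse_insert n (g : 'S_n) i k x :
  i = ord_max \/ i = lift ord_max k ->
  collapse k (insert g i x) = collapse k x \/
  collapse k (insert g i x) = g (collapse k x).
Proof.
case: (unliftP ord_max x) => [y ->|->] ik; last first.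
  case: ik => ->; first by left; rewrite insert_id.
  by right; rewrite insert_max collapse_lift collapse_max.
have [i_y|/insert_lift ->] := eqVneq i (lift ord_max y); last first.
  by right; rewrite !collapse_lift.
rewrite -i_y insert_id collapse_max i_y collapse_lift; left.
by case: ik i_y => [-> /esym/eqP|-> /lift_inj //]; rewrite liftF.
Qed.

Lemma porbit_insert n (g : 'S_n) k x :
  porbit (insert g (lift ord_max k)) x =
  collapse k @^-1: porbit g (collapse k x).
Proof.
set s := insert g _; have s_k : s (lift ord_max k) = ord_max by apply: insert_id.
have max_k w : (ord_max \in porbit s w) = (lift ord_max k \in porbit s w).
  by rewrite -{1}s_k mem_porbit_perm.
have lift_sub y : porbit g y \subset lift ord_max @^-1: porbit s (lift ord_max y).
  apply: porbit_invariant => [z|]; rewrite !inE ?porbit_id //.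
  (* At [k] the cycle of [s] makes a detour through [ord_max] before reaching [g k]. *)
  have [->|zk] := eqVneq z k.
    by rewrite -insert_max -/s mem_porbit_perm max_k.
  rewrite -(@insert_lift _ g (lift ord_max k)) -/s ?mem_porbit_perm //.
  by rewrite (inj_eq lift_inj) eq_sym.
have collapseK y : porbit s (lift ord_max (collapse k y)) = porbit s y.
  case: (unliftP ord_max y) => [z ->|->]; first by rewrite collapse_lift.
  by apply/eqP; rewrite collapse_max eq_porbit_mem -max_k porbit_id.
apply/eqP; rewrite eqEsubset; apply/andP; split.
  apply: porbit_invariant => [y|]; rewrite !inE ?porbit_id //.
  have [->|->] := @collapse_insert n g _ k y (or_intror erefl); first by [].
  by rewrite mem_porbit_perm.
apply/subsetP => y; rewrite inE => /(subsetP (lift_sub _)).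
by rewrite inE collapseK -!eq_porbit_mem collapseK.
Qed.

Lemma card_collapse n (k : 'I_n) (C : {set 'I_n}) :
  #|collapse k @^-1: C| = #|C| + (k \in C).
Proof.
rewrite -[LHS]sum1_card -[X in X + _]sum1_card big_mkcond /= big_ord_recr /=.
rewrite inE collapse_max [in RHS]big_mkcond /=; congr (_ + _).
apply: eq_bigr => y _; rewrite inE.
have -> : widen_ord (leqnSn n) y = lift ord_max y.
  by apply: val_inj; rewrite /= /bump leqNgt ltn_ord.
by rewrite collapse_lift.
Qed.

Lemma porbits_insert_lift n (g : 'S_n) k :
  porbits (insert g (lift ord_max k)) =
  [set collapse k @^-1: C | C : {set 'I_n} in porbits g].
Proof.
apply/setP => C; apply/imsetP/imsetP => [[x _ ->]|[_ /imsetP[y _ ->] ->]].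
  by exists (porbit g (collapse k x)); rewrite ?imset_f // porbit_insert.
by exists (lift ord_max y); rewrite // porbit_insert collapse_lift.
Qed.

Lemma insert_ord_max n (g : 'S_n) :
  insert g ord_max = lift_perm ord_max ord_max g.
Proof. by rewrite /insert tperm1 mul1g. Qed.

Lemma porbits_insert_max n (g : 'S_n) :
  porbits (insert g ord_max) =
  [set ord_max] |: [set lift ord_max @: (C : {set 'I_n}) | C in porbits g].
Proof.
rewrite insert_ord_max; set s := lift_perm _ _ g.
have orb_max : porbit s ord_max = [set ord_max].
  apply/eqP; rewrite eqEsubset sub1set porbit_id andbT.
  by apply: porbit_invariant => [y|]; rewrite !inE // => /eqP->; rewrite lift_perm_id.
have orb_lift y : porbit s (lift ord_max y) = lift ord_max @: porbit g y.
  apply/eqP; rewrite eqEsubset; apply/andP; split.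
    apply: porbit_invariant => [_ /imsetP[z zy ->]|]; last exact/imset_f/porbit_id.
    by rewrite lift_perm_lift imset_f // mem_porbit_perm.
  rewrite sub_imset_pre; apply: porbit_invariant => [z|]; rewrite !inE ?porbit_id //.
  by rewrite -(lift_perm_lift ord_max ord_max) -/s mem_porbit_perm.
apply/setP => C; apply/imsetP/setU1P => [[x _ ->]|[->|/imsetP[_ /imsetP[y _ ->] ->]]].
- case: (unliftP ord_max x) => [y ->|->]; last by left.
  by right; rewrite orb_lift; apply/imset_f/imset_f.
- by exists ord_max.
by exists (lift ord_max y).
Qed.

Lemma big_porbits_insert_lift (R : Type) (idx : R) (op : Monoid.com_law idx)
    n (g : 'S_n) k (F : nat -> R) :
  \big[op/idx]_(C in porbits (insert g (lift ord_max k))) F #|C| =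
  \big[op/idx]_(C in porbits g) F (#|C| + (k \in C)).
Proof.
rewrite porbits_insert_lift big_imset /=.
  by apply: eq_bigr => C _; rewrite card_collapse.
move=> B C _ _ /setP eqBC; apply/setP => y.
by have := eqBC (lift ord_max y); rewrite !inE collapse_lift.
Qed.

Lemma big_porbits_insert_max (R : Type) (idx : R) (op : Monoid.com_law idx)
    n (g : 'S_n) (F : nat -> R) :
  \big[op/idx]_(C in porbits (insert g ord_max)) F #|C| =
  op (F 1%N) (\big[op/idx]_(C in porbits g) F #|C|).
Proof.
rewrite porbits_insert_max big_setU1 /=; last first.
  apply/imsetP => -[C _ /setP/(_ ord_max)]; rewrite set11 => /esym/imsetP[y _].
  by move/eqP; rewrite (negPf (neq_lift _ _)).
rewrite cards1 big_imset /=; last by move=> B C _ _; apply/imset_inj/lift_inj.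
by congr (op _ _); apply: eq_bigr => C _; rewrite card_imset //; apply: lift_inj.
Qed.

Lemma card_porbits_insert n (g : 'S_n) i :
  #|porbits (insert g i)| = #|porbits g| + (i == ord_max).
Proof.
rewrite -!sum1_card; case: (unliftP ord_max i) => [k ->|->].
  by rewrite (big_porbits_insert_lift _ _ _ (fun=> 1%N)) liftF addn0.
by rewrite (big_porbits_insert_max _ _ (fun=> 1%N)) eqxx addnC.
Qed.

(** * Transitivity, and invariance under simultaneous conjugation *)

(** Connectedness in terms of stable sets, which can be pulled back along [collapse] and [lift]
    where group elements cannot. Stability is an equality so that it passes to complements; the
    condition on sets is vacuous for [n = 0], hence [0 < n]. *)
Lemma transitive_pairP n (a b : 'S_n) :
  reflect (0 < n /\ forall (S : {set 'I_n}) x, x \in S ->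
             (forall y, (a y \in S) = (y \in S)) ->
             (forall y, (b y \in S) = (y \in S)) -> S = setT)
          (transitive_list [tuple a; b]).
Proof.
set G := <<[set g in [tuple a; b]]>>.
have [Ga Gb] : a \in G /\ b \in G by split; apply/mem_gen; rewrite !inE eqxx ?orbT.
apply: (iffP idP) => [/imsetP[x0 _ orb_x0] | [n_gt0 conn]]; last first.
  apply/imsetP; exists (Ordinal n_gt0) => //.
  have inv g y : g \in G ->
      (g y \in orbit 'P G (Ordinal n_gt0)) = (y \in orbit 'P G (Ordinal n_gt0)).
    by move=> Gg; exact: (orbit_actr 'P _ _ Gg).
  by apply/esym/(conn _ (Ordinal n_gt0)) => [|y|y]; rewrite ?orbit_refl ?inv.
split=> [|S x Sx aS bS]; first exact: leq_ltn_trans (ltn_ord x0).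
have nS : [acts G, on S | 'P].
  rewrite gen_subG; apply/subsetP => g; rewrite !inE => /orP[]/eqP->;
  by apply/subsetP => y; rewrite inE /= apermE ?aS ?bS.
have x_x0 : x \in orbit 'P G x0 by rewrite -orb_x0.
by apply/eqP; rewrite -subTset orb_x0 -(orbit_eqP x_x0) acts_sub_orbit.
Qed.

Lemma transitive_completion n (t : 2.-tuple 'S_n) :
  transitive_list (completion t) = transitive_list t.
Proof.
rewrite /transitive_list; congr atrans.
apply/eqP; rewrite eqEsubset !gen_subG; apply/andP.
have g_in (g : 'S_n) (s : seq 'S_n) : g \in s -> g \in <<[set h in s]>>.
  by move=> sg; apply: mem_gen; rewrite inE.
have tE i : tnth t i \in <<[set h in t]>> by apply/g_in/mem_tnth.
split; apply/subsetP => g; rewrite !inE.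
  by case/or3P=> // /eqP->; rewrite ?groupV ?groupM ?tE.
case/tnthP=> i ->; apply: g_in; rewrite !inE.
have [->|->] : i = ord0 \/ i = ord_max.
  by case: i => -[|[|//]] ?; [left|right]; apply: val_inj.
  by rewrite eqxx.
by rewrite eqxx orbT.
Qed.

Lemma pair_eta T (t : 2.-tuple T) : t = [tuple tnth t ord0; tnth t ord_max].
Proof.
by case/tupleP: t => x t; case/tupleP: t => y t; rewrite tuple0; apply: val_inj.
Qed.

Lemma n_act_pair n (a b u : 'S_n) :
  n_act 'J [tuple a; b] u = [tuple a ^ u; b ^ u].
Proof. exact: val_inj. Qed.

Lemma completion_conj n (t : 2.-tuple 'S_n) u :
  completion (n_act 'J t u) = n_act 'J (completion t) u.
Proof.
rewrite [t]pair_eta; apply: val_inj => /=.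
by rewrite !(tnth_nth 1) /= conjVg conjMg.
Qed.

Lemma big_constellation_conj (R : Type) (idx : R) (op : Monoid.com_law idx)
    n (c : 3.-tuple 'S_n) u i (F : nat -> R) :
  \big[op/idx]_(C in porbits (tnth (n_act 'J c u) i)) F #|C| =
  \big[op/idx]_(C in porbits (tnth c i)) F #|C|.
Proof. by rewrite tnth_map big_porbits_conj. Qed.

Lemma planar_conj n (c : 3.-tuple 'S_n) u : planar (n_act 'J c u) = planar c.
Proof.
congr (_ == _); apply: eq_bigr => i _; rewrite -!sum1_card.
exact: (big_constellation_conj _ _ _ _ (fun=> 1%N)).
Qed.

Lemma weighted_count_conj A n (c : 3.-tuple 'S_n) u :
  weighted_count A (n_act 'J c u) = weighted_count A c.
Proof. by apply: eq_bigr => i _; apply: big_constellation_conj. Qed.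

Lemma card_exceptional A n (c : 3.-tuple 'S_n) i :
  #|[set C in porbits (tnth c i) | exceptional (tnth A i) #|C|]| =
  \sum_(C in porbits (tnth c i)) exceptional (tnth A i) #|C|.
Proof.
rewrite -sum1_card big_mkcond [RHS]big_mkcond /=.
by apply: eq_bigr => C _; rewrite inE; case: (C \in _); case: exceptional.
Qed.

Lemma card_E_conj A n (c : 3.-tuple 'S_n) u :
  card_E A (n_act 'J c u) = card_E A c.
Proof.
apply: eq_bigr => i _; rewrite !card_exceptional.
exact: (big_constellation_conj _ _ _ _ (fun e => nat_of_bool (exceptional _ e))).
Qed.

Lemma mem_conj_class n m (t : m.-tuple 'S_n) u : n_act 'J t u \in conj_class t.
Proof. exact/mem_orbit/in_setT. Qed.

Lemma conj_classP n m (t t' : m.-tuple 'S_n) :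
  reflect (exists u, t' = n_act 'J t u) (t' \in conj_class t).
Proof.
by apply: (iffP orbitP) => [[u _ <-]|[u ->]]; exists u.
Qed.

Lemma transitive_pair_conj n (t : 2.-tuple 'S_n) u :
  transitive_list (n_act 'J t u) = transitive_list t.
Proof.
have conj_trans (s : 2.-tuple 'S_n) v :
      transitive_list s -> transitive_list (n_act 'J s v).
  rewrite [s]pair_eta n_act_pair => /transitive_pairP[n_gt0 conn].
  apply/transitive_pairP; split=> // S x Sx aS bS.
  have /setP S'T : v @^-1: S = setT.
    apply: (conn _ (v^-1 x)) => [|y|y]; rewrite !inE ?permKV //.
      by rewrite -permJ aS.
    by rewrite -permJ bS.
  by apply/setP => y; have := S'T (v^-1 y); rewrite !inE permKV.
apply/idP/idP; last exact: conj_trans.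
have tK : n_act 'J (n_act 'J t u) u^-1 = t := actK ('J * 2)%act u t.
by move/(conj_trans _ u^-1); rewrite tK.
Qed.

Lemma planar_pair n (a b : 'S_n) :
  planar (completion [tuple a; b]) =
  (#|porbits a| + #|porbits b| + #|porbits (a * b)| == n.+2).
Proof.
rewrite /planar; congr (_ == _).
by rewrite !big_ord_recl big_ord0 addn0 addnA !(tnth_nth 1) /= porbitsV.
Qed.

(** * Existence of a deletable edge *)

(* Otherwise the face of each edge would be stable under [a], so there would be
   only one face, while the absence of leaves gives at most [n] vertices. *)
Lemma leaf_or_two_sided_edge n (a b : 'S_n) :
  transitive_list [tuple a; b] -> planar (completion [tuple a; b]) ->
  exists y, [\/ a y = y, b (a y) = a y | y \notin porbit (a * b) (a y)].
Proof.
move=> /transitive_pairP[n_gt0 conn]; rewrite planar_pair => /eqP euler.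
pose bad y := [|| a y == y, b (a y) == a y | y \notin porbit (a * b) (a y)].
have [/existsP[y /or3P[/eqP|/eqP|]]|/existsPn good] := boolP [exists y, bad y].
- by exists y; constructor 1.
- by exists y; constructor 2.
- by exists y; constructor 3.
have fix_a y : a y != y by have := good y; rewrite !negb_or => /and3P[].
have fix_b y : b y != y.
  by have := good (a^-1 y); rewrite !negb_or permKV => /and3P[].
have face y : porbit (a * b) (a y) = porbit (a * b) y.
  apply/eqP; rewrite eq_sym eq_porbit_mem.
  by have := good y; rewrite !negb_or negbK => /and3P[].
pose x0 := Ordinal n_gt0.
have one_face : porbit (a * b) x0 = setT.
  have stable_a y : (a y \in porbit (a * b) x0) = (y \in porbit (a * b) x0).
    by rewrite -!eq_porbit_mem face.
  apply: (conn _ x0) => [|//|y]; first exact: porbit_id.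
  (* [b y] is the image of [a^-1 y] under [a * b], so stability under [b] follows from stability
     under [a]. *)
  by rewrite -(permKV a y) -permM mem_porbit_perm stable_a.
have card_ab : #|porbits (a * b)| <= 1.
  have -> : porbits (a * b) = [set setT]; last by rewrite cards1.
  apply/setP => C; rewrite inE; apply/imsetP/eqP => [[y _ ->]|->].
    by rewrite -one_face; apply/eqP; rewrite eq_porbit_mem one_face.
  by exists x0.
have few (s : 'S_n) : (forall y, s y != y) -> 2 * #|porbits s| <= n.
  move=> fix_s; have := @card_porbits_bound _ s 2 pred0; rewrite card_ord /=.
  rewrite [X in _ + _ * X](_ : _ = 0) ?muln0 ?addn0; last first.
    by apply: eq_card0 => C; rewrite !inE andbF.
  apply=> _ /imsetP[y _ ->]; rewrite addn0.
  have <- : #|[set y; s y]| = 2 by rewrite cards2 eq_sym fix_s.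
  by rewrite subset_leq_card // subUset !sub1set porbit_id mem_porbit_perm porbit_id.
(* At most [n] vertices and one face fall short of the [n + 2] required by Euler's formula. *)
by have := few a fix_a; have := few b fix_b; lia.
Qed.

(** * Weights under insertion *)

Definition total_weight n k (g : 'S_n) : rat :=
  (\sum_(C in porbits g) cycle_weight (Some k) #|C|)%R.

Lemma weighted_count_pair k l n (a b : 'S_n) :
  weighted_count [tuple Some k; Some l; None] (completion [tuple a; b]) =
  (total_weight k a + total_weight l b + #|porbits (a * b)|%:R)%R.
Proof.
rewrite /weighted_count !big_ord_recl big_ord0 /= !(tnth_nth 1) /=.
by rewrite porbitsV sumr_const addr0 addrA.
Qed.

(** The weights are 0, 1/2 on the residues 0, 1 modulo 2, and 0, 1, 1/2 on the residues 0, 1, 2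
    modulo 3: passing to the next residue never loses more than 1/2. *)
Lemma cycle_weightS k e :
  (k == 2) || (k == 3) ->
  (cycle_weight (Some k) e <= cycle_weight (Some k) e.+1 + 1 / 2)%R.
Proof.
case/orP=> /eqP->; rewrite /cycle_weight;
  case: ifP => e0; case: ifP => e1; try case: ifP => e2; first [lra | lia].
Qed.

Lemma total_weight_insert_lift n k (g : 'S_n) y :
  (k == 2) || (k == 3) ->
  (total_weight k g <= total_weight k (insert g (lift ord_max y)) + 1 / 2)%R.
Proof.
move=> k23; rewrite /total_weight big_porbits_insert_lift.
rewrite (bigD1 (porbit g y)) ?imset_f //= [in leRHS](bigD1 (porbit g y)) ?imset_f //=.
rewrite porbit_id addn1 addrAC.
apply: lerD; first exact: cycle_weightS.
rewrite le_eqVlt; apply/orP; left; apply/eqP.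
apply: eq_bigr => C /andP[/imsetP[x _ ->]].
by rewrite eq_sym eq_porbit_mem => /negPf->; rewrite addn0.
Qed.

Lemma total_weight_insert_max n k (g : 'S_n) :
  total_weight k (insert g ord_max) =
  (cycle_weight (Some k) 1 + total_weight k g)%R.
Proof. exact: (big_porbits_insert_max _ _ (cycle_weight (Some k))). Qed.

(** * Deleting an edge *)

(** Otherwise the new edge would be isolated, with [[set ord_max]] a proper stable set. *)
Lemma insert_neq_max n (a b : 'S_n) i j :
  0 < n -> transitive_list [tuple insert a i; insert b j] ->
  (i, j) != (ord_max, ord_max).
Proof.
move=> n_gt0 /transitive_pairP[_ conn]; apply/eqP => -[i_max j_max].
have stable (g : 'S_n) y :
    (insert g ord_max y \in [set ord_max]) = (y \in [set ord_max]).
  by rewrite !inE -{2}(insert_id g ord_max) (inj_eq perm_inj).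
have := conn [set ord_max] ord_max (set11 _); rewrite i_max j_max.
move=> /(_ (stable a) (stable b)) /setP/(_ (lift ord_max (Ordinal n_gt0))).
by rewrite !inE liftF.
Qed.

(* The part of the face from [i] up to [i] avoids [ord_max], so it is a walk from
   the white end of the deleted edge to its black end in the remaining graph. *)
Lemma two_sided_linked n (a b : 'S_n) i j (S : {set 'I_n}) :
  let f := insert a (lift ord_max i) * insert b (lift ord_max j) in
  lift ord_max i \notin porbit f ord_max ->
  (forall y, (a y \in S) = (y \in S)) -> (forall y, (b y \in S) = (y \in S)) ->
  (i \in S) = (j \in S).
Proof.
move=> f i_max aS bS.
have f_i : f (lift ord_max i) = lift ord_max (b j).
  by rewrite permM insert_id insert_max.
have link (P : {set 'I_n}) :
    (forall y, (a y \in P) = (y \in P)) -> (forall y, (b y \in P) = (y \in P)) ->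
    j \in P -> i \in P.
  move=> aP bP jP.
  (* [Q] is closed under [f] and contains [lift ord_max (b j)], the successor of [lift ord_max i];
     going round the face therefore brings [i] into [P]. *)
  pose Q := [set w in porbit f (lift ord_max i) | collapse i w \in P].
  have Qf w : w \in Q -> f w \in Q.
    rewrite !inE mem_porbit_perm => /andP[w_i wP]; rewrite w_i /=.
    have [-> | w_neq_i] := eqVneq w (lift ord_max i).
      by rewrite f_i collapse_lift bP.
    case: (unliftP ord_max w) wP w_neq_i w_i => [y ->|->]; last first.
      by rewrite porbit_sym (negPf i_max).
    rewrite collapse_lift eq_sym => yP y_i y_orb.
    rewrite permM insert_lift //.
    (* If [a y] were [j], the walk would step to [ord_max], which lies on another face. *)
    have [j_ay | j_ay] := eqVneq (lift ord_max j) (lift ord_max (a y)).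
      have f_y : f (lift ord_max y) = ord_max.
        by rewrite permM insert_lift // -j_ay insert_id.
      by move: i_max; rewrite porbit_sym -{1}f_y mem_porbit_perm y_orb.
    by rewrite insert_lift // collapse_lift bP aP.
  have : f (lift ord_max i) \in Q.
    by rewrite inE mem_porbit_perm porbit_id f_i collapse_lift bP.
  move=> /(porbit_invariant Qf)/subsetP/(_ (lift ord_max i)).
  by rewrite porbit_sym mem_porbit_perm porbit_id inE collapse_lift => /(_ isT)/andP[].
apply/idP/idP; last exact: link.
(* The converse is [link] applied to the complement of [S]. *)
apply: contraTT; rewrite -!in_setC; apply: link => y; rewrite !inE ?aS ?bS //.
Qed.

(** A stable set [S] of the smaller map pulls back along [collapse k] to a stable set of the larger
    one, where [k] is the old edge after which the new one was inserted. If both insertions have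
    such an edge, the two pullbacks agree, because [two_sided_linked] puts both edges in [S] or both
    outside. *)
Lemma transitive_delete n (a b : 'S_n) i j :
  0 < n -> transitive_list [tuple insert a i; insert b j] ->
  [\/ i = ord_max, j = ord_max
    | i \notin porbit (insert a i * insert b j) ord_max] ->
  transitive_list [tuple a; b].
Proof.
move=> n_gt0 tr; have ij := insert_neq_max n_gt0 tr.
move: tr => /transitive_pairP[_ conn] del.
apply/transitive_pairP; split=> // S x Sx aS bS.
have stable (g : 'S_n) l k y : (forall y, (g y \in S) = (y \in S)) ->
    l = ord_max \/ l = lift ord_max k ->
    (insert g l y \in collapse k @^-1: S) = (y \in collapse k @^-1: S).
  by move=> gS lk; rewrite !inE; have [->|->] := collapse_insert g y lk.
have full k (S' := collapse k @^-1: S) :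
    (forall y, (insert a i y \in S') = (y \in S')) ->
    (forall y, (insert b j y \in S') = (y \in S')) ->
    S = setT.
  move=> aS' bS'; have /setP S'T : collapse k @^-1: S = setT.
    by apply: (conn _ (lift ord_max x)); rewrite // inE collapse_lift.
  by apply/setP => y; have := S'T (lift ord_max y); rewrite !inE collapse_lift.
case: (unliftP ord_max i) ij full del => [i0 ->|->];
  case: (unliftP ord_max j) => [j0 ->|->] ij full del.
- have linked : (i0 \in S) = (j0 \in S).
    case: del => [/eqP|/eqP|]; [by rewrite liftF|by rewrite liftF|].
    by move=> /two_sided_linked; apply.
  have same : collapse i0 @^-1: S = collapse j0 @^-1: S.
    apply/setP => y; rewrite !inE.
    by case: (unliftP ord_max y) => [z ->|->]; rewrite ?collapse_lift ?collapse_max.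
  apply: (full i0) => y; first by apply: stable => //; right.
  by rewrite same; apply: stable => //; right.
- by apply: (full i0) => y; apply: stable => //; [right|left].
- by apply: (full j0) => y; apply: stable => //; [left|right].
by rewrite eqxx in ij.
Qed.

(** The product fixes [y] and sends [x] to [s y]: it cuts [y] out of its cycle as a new 1-cycle. *)
Lemma card_porbits_tperm_mul (T : finType) (s : {perm T}) x y :
  s x = y -> x != y -> #|porbits (tperm x y * s)| = #|porbits s| + 1.
Proof.
move=> sx xy; have := porbits_mul_tperm s x y; rewrite xy /=.
by rewrite -sx porbit_sym mem_porbit_perm porbit_id /= addn0.
Qed.

(** Inserting [ord_max] as a 1-cycle in both factors gives the faces of [a * b] and one extra
    1-cycle. This product is obtained from [f] by at most two transpositions on the left, and each
    one merges two cycles or splits one. *)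
Lemma card_faces_delete n (a b : 'S_n) i j :
  let f := insert a i * insert b j in
  (i, j) != (ord_max, ord_max) ->
  [\/ i = ord_max, j = ord_max | i \notin porbit f ord_max] ->
  #|porbits f| = #|porbits (a * b)| + ((i != ord_max) && (j != ord_max)).
Proof.
move=> f ij del.
have insertE (g : 'S_n) l : insert g ord_max = tperm l ord_max * insert g l.
  by rewrite insert_ord_max /insert mulgA tperm2 mul1g.
have := card_porbits_insert (a * b) ord_max; rewrite eqxx.
rewrite insert_ord_max -(lift_permM _ ord_max) -!insert_ord_max.
rewrite (insertE a i) (insertE b j).
(* [k] is the predecessor of [ord_max] on its face. *)
pose k := (insert a i)^-1 j.
have ak : insert a i k = j by rewrite permKV.
have swap : insert a i * tperm j ord_max = tperm k i * insert a i.
  by rewrite -ak -(insert_id a i) -tpermJ -conjgC.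
have -> : tperm i ord_max * insert a i * (tperm j ord_max * insert b j) =
          tperm i ord_max * (tperm k i * f).
  rewrite /f -(mulgA (tperm i ord_max)) (mulgA (insert a i)) swap.
  by rewrite -(mulgA (tperm k i)).
have f_k : f k = ord_max by rewrite permM ak insert_id.
case: (eqVneq i ord_max) ij del => [i_max|i_max] ij del /=.
  have k_max : k != ord_max.
    apply: contraNneq ij => k_max.
    by rewrite -ak k_max i_max (insert_id a ord_max).
  by rewrite i_max tperm1 mul1g card_porbits_tperm_mul // => /addIn ->; rewrite addn0.
have [j_max|j_max] /= := eqVneq j ord_max.
  have -> : k = i by apply: (@perm_inj _ (insert a i)); rewrite ak insert_id.
  rewrite tperm1 mul1g card_porbits_tperm_mul //.
    by move=> /addIn ->; rewrite addn0.
  by rewrite permM insert_id -[in LHS]j_max insert_id.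
have {del} i_f : i \notin porbit f ord_max.
  by case: del => // [/eqP|/eqP]; rewrite ?(negPf i_max) ?(negPf j_max).
have k_f : k \in porbit f ord_max by rewrite porbit_sym -f_k mem_porbit_perm porbit_id.
have k_i : k != i by apply: contraNneq i_f => <-.
(* [tperm k i] merges the distinct faces of [k] and [i]; afterwards [i] is sent to [ord_max], so
   [tperm i ord_max] splits off a 1-cycle. *)
rewrite card_porbits_tperm_mul //; last by rewrite permM tpermR.
have := porbits_mul_tperm f k i; rewrite k_i /=.
suff -> : k \notin porbit f i by lia.
apply: contra i_f => k_i'; rewrite porbit_sym -f_k mem_porbit_perm //.
Qed.

Lemma delete_edge k l n (a b : 'S_n) i j :
  (k == 2) || (k == 3) -> (l == 2) || (l == 3) ->
  0 < n -> transitive_list [tuple insert a i; insert b j] ->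
  planar (completion [tuple insert a i; insert b j]) ->
  [\/ i = ord_max, j = ord_max
    | i \notin porbit (insert a i * insert b j) ord_max] ->
  [/\ transitive_list [tuple a; b], planar (completion [tuple a; b])
    & (weighted_count [tuple Some k; Some l; None] (completion [tuple a; b]) <=
       weighted_count [tuple Some k; Some l; None]
         (completion [tuple insert a i; insert b j]))%R].
Proof.
move=> k23 l23 n_gt0 tr pl del; have ij := insert_neq_max n_gt0 tr.
have faces := card_faces_delete ij del.
split; first exact: transitive_delete tr del.
  move: pl; rewrite !planar_pair !card_porbits_insert faces.
  by move: ij; rewrite xpair_eqE; case: (i == _); case: (j == _) => //= _; lia.
rewrite !weighted_count_pair faces natrD.
(* A 1-cycle weighs 1/2 for [m = 2] and 1 for [m = 3], enough to offset the loss at the other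
   end. *)
have leaf m : (m == 2) || (m == 3) -> (1 / 2 <= cycle_weight (Some m) 1)%R.
  by case/orP=> /eqP-> /=; lra.
case: (unliftP ord_max i) ij => [i0 ->|->]; case: (unliftP ord_max j) => [j0 ->|->] ij.
- rewrite !liftF /=.
  have := total_weight_insert_lift a i0 k23.
  have := total_weight_insert_lift b j0 l23; lra.
- rewrite liftF eqxx /= total_weight_insert_max.
  have := total_weight_insert_lift a i0 k23; have := leaf l l23; lra.
- rewrite liftF eqxx /= total_weight_insert_max.
  have := total_weight_insert_lift b j0 l23; have := leaf k k23; lra.
by rewrite eqxx in ij.
Qed.

(** * Inserting an edge *)

(** A stable set of the larger map restricts to one of the smaller map, since a cycle that detours
    through [ord_max] returns to its old course. The new edge is adjacent to an old one because [i]
    or [j] differs from [ord_max]. *)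
Lemma transitive_insert n (a b : 'S_n) i j :
  (i, j) != (ord_max, ord_max) -> transitive_list [tuple a; b] ->
  transitive_list [tuple insert a i; insert b j].
Proof.
move=> ij /transitive_pairP[_ conn]; apply/transitive_pairP; split=> // S x Sx aS bS.
have stable (g : 'S_n) k : (forall y, (insert g k y \in S) = (y \in S)) ->
    forall y, (g y \in lift ord_max @^-1: S) = (y \in lift ord_max @^-1: S).
  move=> gS y; rewrite !inE; have [k_y|k_y] := eqVneq k (lift ord_max y).
    by rewrite -insert_max -k_y gS -[in LHS](insert_id g k) gS.
  by rewrite -(insert_lift g k_y) gS.
have [k Sk] : exists k, (lift ord_max k \in S) = (ord_max \in S).
  case: (unliftP ord_max i) ij aS => [k ->|->];
    case: (unliftP ord_max j) bS => [l ->|->] bS ij aS.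
  - by exists k; rewrite -aS insert_id.
  - by exists k; rewrite -aS insert_id.
  - by exists l; rewrite -bS insert_id.
  by rewrite eqxx in ij.
have [y Sy] : exists y, lift ord_max y \in S.
  case: (unliftP ord_max x) Sx => [y ->|-> Sx]; first by exists y.
  by exists k; rewrite Sk.
have full : lift ord_max @^-1: S = setT.
  by apply: (conn _ y); rewrite ?inE //; [apply: (stable a i)|apply: (stable b j)].
have Sl z : lift ord_max z \in S by move/setP: full => /(_ z); rewrite !inE.
apply/setP => z; rewrite inE.
by case: (unliftP ord_max z) => [w ->|->]; rewrite -?Sk Sl.
Qed.

(** Relabelling before an insertion amounts to relabelling after it with [ord_max] fixed. Hence
    inserting into class representatives only loses no class. *)
Lemma insert_conj n (g v : 'S_n) i :
  insert g i ^ lift_perm ord_max ord_max v =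
  insert (g ^ v) (lift_perm ord_max ord_max v i).
Proof.
rewrite /insert conjMg tpermJ lift_perm_id; congr (_ * _).
by rewrite !conjgE lift_permV !lift_permM.
Qed.

Lemma transitive_degree_gt0 n (t : 2.-tuple 'S_n) : transitive_list t -> 0 < n.
Proof. by rewrite [t]pair_eta => /transitive_pairP[]. Qed.

Lemma pair_S1 (t : 2.-tuple 'S_1) : t = [tuple 1; 1].
Proof.
have S1 (g : 'S_1) : g = 1 by apply/permP => x; rewrite [LHS]ord1 [RHS]ord1.
by apply: eq_from_tnth => i; rewrite [LHS]S1 [RHS]S1.
Qed.

(** * Constellations as pairs, and the degree bound *)

Lemma completion_constellation n (c : 3.-tuple 'S_n) :
  constellation c -> exists2 t, c = completion t & transitive_list t.
Proof.
case/andP=> /eqP prod_c tr_c; pose t := [tuple tnth c ord0; tnth c (lift ord0 ord0)].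
suff ct : c = completion t by exists t; rewrite // -transitive_completion -ct.
move: prod_c {tr_c}; rewrite {}/t; case/tupleP: c => a c; case/tupleP: c => b c.
case/tupleP: c => g c; rewrite tuple0 => {c}.
rewrite !big_ord_recl big_ord0 !(tnth_nth 1) /= mulg1 mulgA => /eqP.
rewrite -eq_invg_mul => /eqP abg; apply: val_inj => /=.
by rewrite !(tnth_nth 1) /= abg.
Qed.

Lemma constellation_completion n (t : 2.-tuple 'S_n) :
  constellation (completion t) = transitive_list t.
Proof.
rewrite /constellation transitive_completion !big_ord_recl big_ord0 !(tnth_nth 1) /=.
by rewrite mulg1 mulgA mulgV eqxx.
Qed.

Lemma completion_inj n : injective (@completion n).
Proof.
by move=> s t /(congr1 val)[s0 s1 _]; rewrite [s]pair_eta s0 s1 -pair_eta.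
Qed.

Lemma weighted_count_le_card_E A n (c : 3.-tuple 'S_n) :
  (weighted_count A c <= (card_E A c)%:R)%R.
Proof.
rewrite /card_E natr_sum ler_sum // => i _.
rewrite card_exceptional natr_sum ler_sum // => C _.
case: (tnth A i) => [k|] //=.
by case: (k %| #|C|) => /=; last case: ifP => _; lra.
Qed.

(** Let [ca], [cb], [cf] count all cycles and [ea], [eb] the exceptional ones; all [cf] faces are
    exceptional. From [3 * ca <= n + 2 * ea] and [2 * cb <= n + eb], Euler's formula gives [6 * (n +
    2) <= 5 * n + 4 * ea + 3 * eb + 6 * cf]. *)
Lemma degree_le n (t : 2.-tuple 'S_n) :
  planar (completion t) ->
  n + 12 <= 6 * card_E [tuple Some 3; Some 2; None] (completion t).
Proof.
rewrite [t]pair_eta; move: (tnth t ord0) (tnth t ord_max) => a b.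
rewrite planar_pair /card_E !big_ord_recl big_ord0 addn0 !(tnth_nth 1) /=.
rewrite !(tnth_nth 1) /= porbitsV.
have bound (s : 'S_n) k := @card_porbits_bound _ s k (fun C => ~~ (k %| #|C|)).
have := bound a 3; have := bound b 2; rewrite /= card_ord.
have ne k (s : 'S_n) C : C \in porbits s -> k <= #|C| + k.-1 * ~~ (k %| #|C|).
  move/card_porbit_gt0; move: #|C| => e e_gt0.
  by case: (boolP (k %| e)) => [/(dvdn_leq e_gt0)|_] /=; lia.
have -> : #|[set C in porbits (a * b) | true]| = #|porbits (a * b)|.
  by apply: eq_card => C; rewrite inE andbT.
move=> /(_ (ne 2 b)) + /(_ (ne 3 a)) + /eqP.
move: #|porbits a| #|porbits b| #|porbits (a * b)| => ca cb cf.
move: #|[set C in porbits a | _]| #|[set C in porbits b | _]| => ea eb.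
lia.
Qed.

(** * Soundness and completeness of the search *)

Lemma unique_representative_conj (U : forall n m : nat, m.-tuple 'S_n -> m.-tuple 'S_n)
    n (t : 2.-tuple 'S_n) u :
  is_unique_representative U ->
  transitive_list t -> U n 2 (n_act 'J t u) = U n 2 t.
Proof. by move=> uniqueU /uniqueU[_ U_t]; apply: U_t; apply: mem_conj_class. Qed.

Lemma unique_representativeE (U : forall n m : nat, m.-tuple 'S_n -> m.-tuple 'S_n)
    n (t : 2.-tuple 'S_n) :
  is_unique_representative U ->
  transitive_list t -> exists u, U n 2 t = n_act 'J t u.
Proof. by move=> uniqueU /uniqueU[] => /conj_classP. Qed.

(** That members are fixed by [U] is what makes conjugate members equal, and so gives uniqueness in
    the theorem. *)
Lemma search_sound (U : forall n m : nat, m.-tuple 'S_n -> m.-tuple 'S_n)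
    A d n (t : 2.-tuple 'S_n) :
  is_unique_representative U ->
  t \in search U A d n ->
  [/\ transitive_list t, planar (completion t) & U n 2 t = t].
Proof.
move=> uniqueU; elim: n t => [|n IHn] t; first by rewrite inE.
case: n IHn t => [|n] IHn t.
  rewrite inE => /eqP->; split; last by rewrite [LHS]pair_S1.
    apply/transitive_pairP; split=> // S x Sx _ _.
    by apply/setP => y; rewrite (ord1 y) -(ord1 x) Sx inE.
  rewrite planar_pair mulg1; have -> : porbits (1 : 'S_1) = [set setT].
    apply/setP => C; rewrite inE; apply/imsetP/eqP => [[x _ ->]|->].
      by apply/setP => y; rewrite (ord1 y) -(ord1 x) porbit_id inE.
    by exists ord0 => //; apply/setP => y; rewrite (ord1 y) porbit_id inE.
  by rewrite cards1.
case/imsetP=> s; rewrite inE => /andP[/imset2P[t' [i j] t'_in]].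
rewrite inE => ij s_def /andP[pl _] ->.
have [tr' _ _] := IHn _ t'_in.
have tr : transitive_list s.
  by rewrite s_def; apply: transitive_insert => //; rewrite -pair_eta.
have [u Us] := unique_representativeE uniqueU tr.
rewrite Us transitive_pair_conj completion_conj planar_conj.
by rewrite unique_representative_conj.
Qed.

Lemma search_complete (U : forall n m : nat, m.-tuple 'S_n -> m.-tuple 'S_n)
    d n (t : 2.-tuple 'S_n) :
  let A := [tuple Some 3; Some 2; None] in
  is_unique_representative U ->
  transitive_list t -> planar (completion t) ->
  n = 1%N \/ (weighted_count A (completion t) <= d%:R)%R ->
  U n 2 t \in search U A d n.
Proof.
move=> A uniqueU; elim: n t => [|n IHn] t tr pl.
  by have := transitive_degree_gt0 tr.
case: n IHn t tr pl => [|n] IHn t tr pl; first by rewrite [U _ _ t]pair_S1 inE.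
case=> // wt; move: tr pl wt; rewrite [t]pair_eta.
move: (tnth t ord0) (tnth t ord_max) => {t} a b tr pl wt.
have [y del] := leaf_or_two_sided_edge tr pl.
(* The edge to delete is [a y]; conjugation by [u] gives it the label [ord_max], and its predecessor
   under [a] becomes [u y]. *)
pose u := tperm (a y) ord_max.
have u_ay : u (a y) = ord_max by rewrite tpermL.
move: tr pl wt; rewrite -(transitive_pair_conj _ u) -(planar_conj _ u).
rewrite -(weighted_count_conj _ _ u) -completion_conj => tr pl wt.
rewrite -(unique_representative_conj u uniqueU) -1?(transitive_pair_conj _ u) //.
move: tr pl wt; rewrite n_act_pair.
have [a' [i ai]] := insertP (a ^ u); have [b' [j bj]] := insertP (b ^ u).
have i_uy : i = u y.
  by apply: (@perm_inj _ (a ^ u)); rewrite permJ u_ay ai insert_id.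
have {}del : [\/ i = ord_max, j = ord_max
                | i \notin porbit (insert a' i * insert b' j) ord_max].
  case: del => [ay|bay|y_f]; [constructor 1|constructor 2|constructor 3].
  - by rewrite i_uy -{1}ay u_ay.
  - apply: (@perm_inj _ (b ^ u)); rewrite [in LHS]bj insert_id.
    by rewrite -u_ay permJ bay.
  rewrite -ai -bj -conjMg i_uy -u_ay porbit_conj mem_imset //; exact: perm_inj.
rewrite ai bj => tr pl wt.
have [tr' pl' le_wt] :=
  @delete_edge 3 2 _ _ _ _ _ isT isT (ltn0Sn n) tr pl del.
have U_in := IHn _ tr' pl' (or_intror (le_trans le_wt wt)).
have [v Uv] := unique_representativeE uniqueU tr'.
(* The search extends the representative of [[tuple a'; b']], reached by [v]. Conjugation by [w]
   turns the given pair into an insertion into that representative at the positions [w i] and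
   [w j]. *)
pose w := lift_perm ord_max ord_max v.
rewrite -(unique_representative_conj w uniqueU tr).
apply: imset_f; rewrite !inE completion_conj planar_conj weighted_count_conj.
rewrite pl wt !andbT.
apply/imset2P; exists (U n.+1 2 [tuple a'; b']) (w i, w j) => //.
  rewrite inE; have := insert_neq_max (ltn0Sn n) tr.
  by rewrite !xpair_eqE -{3 4}(lift_perm_id ord_max ord_max v) !(inj_eq perm_inj).
by rewrite n_act_pair Uv n_act_pair !insert_conj; apply: val_inj.
Qed.

Theorem mainTheorem5 :
  forall (U : forall n m : nat, m.-tuple 'S_n -> m.-tuple 'S_n) (d : nat),
  is_unique_representative U ->
  0 < d ->
  let A := [tuple Some 3; Some 2; None] in
  (forall (n : nat) (c : 3.-tuple 'S_n),
     constellation c -> planar c -> card_E A c = d ->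
     exists! t : 2.-tuple 'S_n,
       t \in search_result U A d n /\ completion t \in dessin c) /\
  (forall (n : nat) (t : 2.-tuple 'S_n),
     t \in search_result U A d n ->
     [/\ constellation (completion t), planar (completion t)
       & card_E A (completion t) = d]).
Proof.
move=> U d uniqueU _ A; split=> n; last first.
  move=> t; rewrite inE => /and3P[/(search_sound uniqueU)[tr pl _] _ /eqP].
  by rewrite constellation_completion.
move=> c /completion_constellation[t -> tr] pl card_d.
have [u Ut] := unique_representativeE uniqueU tr.
exists (U n 2 t); split=> [|s [s_in s_t]].
  rewrite {2}Ut completion_conj mem_conj_class inE Ut; split=> //.
  rewrite completion_conj card_E_conj card_d eqxx andbT -Ut.
  rewrite search_complete //=; last by right; rewrite -card_d weighted_count_le_card_E.
  (* [n + 12 <= 6 * d] is the bound [n <= 6 * (d - 2)], and it excludes a negative right-hand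
     side. *)
  by have := degree_le pl; rewrite -/A card_d; lia.
have s_search : s \in search U A d n by move: s_in; rewrite inE => /andP[].
have [_ _ <-] := search_sound uniqueU s_search.
(* Since a pair is determined by its completion, [s] is conjugate to [t]; being its own
   representative, it equals that of [t]. *)
have /conj_classP[v] := s_t; rewrite -completion_conj => /completion_inj ->.
by rewrite unique_representative_conj.
Qed.
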